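(* Let $Sp$ be an unbalanced split graph. Then: (1) $W(Sp)=\{v\in V(Sp):\deg_{Sp}(v)=\omega(Sp)-1\}$. (2) $W(Sp)$ is a clique or an independent set of mutually twin vertices. (3) If $W(Sp)=\{w\}$, then $\operatorname{Supp}(Sp)\subseteq S^*(Sp)\cup\{w\}$. (4) If $W(Sp)$ is a clique of size $\ge 2$, then $\operatorname{Supp}(Sp)\subseteq S^*(Sp)$; in particular, $W(Sp)\cap\operatorname{Supp}(Sp)=\varnothing$. (5) If $W(Sp)$ is an independent set of size $\ge 2$, then $W(Sp)\subseteq\operatorname{Supp}(Sp)\subseteq S^*(Sp)\cup W(Sp)$.
   Context: Graphs are finite and simple. A split graph is a graph $Sp$ with at least one vertex whose vertex set is a disjoint union of a clique $K$ and an independent set $S$; such a pair $(K,S)$ is called an s-partition for $Sp$ (here one of the two parts may be empty). $\omega(Sp)$ and $\alpha(Sp)$ are the clique number and independence number. A split graph with s-partition $(K,S)$ is balanced if $|K|=\omega(Sp)$ and $|S|=\alpha(Sp)$, and unbalanced otherwise (this does not depend on the s-partition chosen). A vertex $w$ is swing if there exist s-partitions $(K,S)$, $(K',S')$ for $Sp$ with $w\in K$ and $w\in S'$; $W(Sp)$ is the set of swing vertices. $S^*(Sp)$ is the intersection of all independent sets $S$ such that $(K,S)$ is an s-partition for $Sp$ for some $K$. Vertices $u,v$ of a graph $G$ are twins if $N_G(u)\setminus\{v\}=N_G(v)\setminus\{u\}$, where $N_G$ denotes the (open) neighborhood. $\operatorname{Supp}(Sp)$ is the set of vertices $v$ such that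 $x_v\ne 0$ for some real vector $x$ in the nullspace of the adjacency matrix of $Sp$. *)

(* Defs.v *)
From HB Require Import structures.
From mathcomp Require Import all_boot all_order all_algebra.
From mathcomp Require Import boolp reals.
From mathcomp Require Import zify.

Set Implicit Arguments.
Unset Strict Implicit.
Unset Printing Implicit Defensive.

Record sgraph := SGraph {
  vertex :> finType;
  adj : rel vertex;
  adj_sym : symmetric adj;
  adj_irrefl : irreflexive adj
}.

Section Graphs.
Variable G : sgraph.
Implicit Types (A K S : {set G}) (u v w : G).

Definition nbhd v : {set G} := [set u | adj v u].

Definition deg v : nat := #|nbhd v|.

(* Adjacent as well as non-adjacent vertices may be twins. *)
Definition twins u v : bool := nbhd u :\ v == nbhd v :\ u.

Definition clique A : bool :=
  [forall u in A, forall v in A, (u != v) ==> adj u v].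

Definition independent A : bool :=
  [forall u in A, forall v in A, ~~ adj u v].

Definition clique_number : nat := \max_(A : {set G} | clique A) #|A|.

Definition independence_number : nat :=
  \max_(A : {set G} | independent A) #|A|.

Definition s_partition K S : bool :=
  [&& K :|: S == [set: G], [disjoint K & S], clique K & independent S].

Definition split_graph : bool :=
  (0 < #|G|) && [exists K : {set G}, exists S : {set G}, s_partition K S].

Definition balanced_partition K S : bool :=
  (#|K| == clique_number) && (#|S| == independence_number).

(* The choice of the s-partition is irrelevant, see [balancedE]. *)
Definition balanced : bool :=
  split_graph && [exists K : {set G}, exists S : {set G},
                    s_partition K S && balanced_partition K S].

Definition unbalanced : bool := split_graph && ~~ balanced.

Definition swing w : bool :=
  [exists K : {set G}, exists S : {set G},
   exists K' : {set G}, exists S' : {set G},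
     [&& s_partition K S, s_partition K' S', w \in K & w \in S']].

Definition swing_set : {set G} := [set w | swing w].

Definition Sstar : {set G} :=
  \bigcap_(P : {set G} * {set G} | s_partition P.1 P.2) P.2.

Lemma s_partition_card K S : s_partition K S -> #|K| + #|S| = #|G|.
Proof.
case/and4P => /eqP KS dKS _ _.
by rewrite -cardsT -KS cardsU disjoint_setI0 // cards0 subn0.
Qed.

Lemma balancedE K S :
  0 < #|G| -> s_partition K S -> balanced = balanced_partition K S.
Proof.
move=> G0 pKS; have sG : split_graph.
  by rewrite /split_graph G0; apply/existsP; exists K; apply/existsP; exists S.
rewrite /balanced sG /=; apply/idP/idP; last first.
  by move=> b; apply/existsP; exists K; apply/existsP; exists S; rewrite pKS.
case/existsP => K' /existsP[S' /andP[pKS' /andP[/eqP cK' /eqP cS']]].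
have := s_partition_card pKS; have := s_partition_card pKS'.
have /and4P[_ _ cK iS] := pKS.
have leK : #|K| <= clique_number by apply: leq_bigmax_cond.
have leS : #|S| <= independence_number by apply: leq_bigmax_cond.
by rewrite /balanced_partition; lia.
Qed.

End Graphs.

Section Support.
Variables (R : realType) (G : sgraph).
Local Open Scope ring_scope.

Definition adjacency_matrix : 'M[R]_#|G| :=
  \matrix_(i, j) (adj (enum_val i : G) (enum_val j))%:R.

Definition Supp : {set G} :=
  [set v | `[< exists x : 'cV[R]_#|G|,
      adjacency_matrix *m x = 0 /\ x (enum_rank v) 0 != 0 >]].

End Support.

(* Main.v *)
Require Import Defs.
From mathcomp Require Import all_boot all_order all_algebra.
From mathcomp Require Import boolp reals.
From mathcomp Require Import zify.

Set Implicit Arguments.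
Unset Strict Implicit.
Unset Printing Implicit Defensive.

(** In an unbalanced split graph every swing vertex [w] is a pivot: the vertex
    set is a disjoint union [K], [{w}], [S] with [w |: K] a clique and
    [w |: S] independent, so that [K] is the neighbourhood of [w] and
    [#|K| + 1] is the clique number.  This gives (1), and comparing degrees
    shows that any two swing vertices are twins, which gives (2).

    If [f] is a null vector, the equation at [w] says that [f] sums to zero
    over [K].  The equation at [k \in K] then expresses [f k] as the sum of [f]
    over the neighbours of [k] in [S]; multiplying by [f k] and summing over
    [K] yields, by the equations at the vertices of [S], that the sum of the
    [f k ^ 2] is zero.  Hence the support avoids [K], for every pivot. *)

Section SplitGraphs.
Variable G : sgraph.
Implicit Types (A C I K S : {set G}) (u v w : G).

(** * Cliques, independent sets and s-partitions *)

Lemma in_nbhd u v : (u \in nbhd v) = adj v u.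
Proof. by rewrite inE. Qed.

Lemma cliqueP A :
  reflect {in A &, forall u v, u != v -> adj u v} (clique A).
Proof.
apply: (iffP forall_inP) => [cA u v uA vA uv|cA u uA].
  by have /forall_inP/(_ v vA)/implyP := cA u uA; apply.
by apply/forall_inP => v vA; apply/implyP; apply: cA.
Qed.

Lemma independentP A :
  reflect {in A &, forall u v, ~~ adj u v} (independent A).
Proof.
apply: (iffP forall_inP) => [iA u v uA vA|iA u uA].
  by have /forall_inP/(_ v vA) := iA u uA.
by apply/forall_inP => v vA; apply: iA.
Qed.

Lemma s_partitionP K S :
  reflect [/\ forall v, (v \in S) = (v \notin K), clique K & independent S]
          (s_partition K S).
Proof.
apply: (iffP and4P) => [[/eqP KS dKS cK iS]|[SK cK iS]]; split=> //.
- move=> v; have : v \in K :|: S by rewrite KS inE.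
  rewrite inE; case: (boolP (v \in K)) => //= vK _.
  by apply/negbTE; rewrite (disjointFr dKS vK).
- by apply/eqP/setP => v; rewrite !inE SK orbN.
- by rewrite disjoint_subset; apply/subsetP => v vK; rewrite inE SK vK.
Qed.

Lemma clique_independent_meet C I :
  clique C -> independent I -> #|C :&: I| <= 1.
Proof.
move=> /cliqueP cC /independentP iI; apply/card_le1_eqP => u v.
rewrite !inE => /andP[uC uI] /andP[vC vI]; apply/eqP.
by apply: contraT => uv; have := iI _ _ vI uI; rewrite cC // eq_sym.
Qed.

Lemma s_partition_setD K S A : s_partition K S -> A :\: K = A :&: S.
Proof. by case/s_partitionP=> SK _ _; apply/setP => v; rewrite !inE SK andbC. Qed.

(** The part of [C] outside [K] lies in the independent set [S], so it has at most one vertex. *)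
Lemma clique_leq K S C : s_partition K S -> clique C -> #|C| <= #|K|.+1.
Proof.
move=> pKS cC; have /s_partitionP[_ _ iS] := pKS.
rewrite -(cardsID K C) (s_partition_setD _ pKS) -addn1.
by rewrite leq_add ?clique_independent_meet // subset_leq_card // subsetIr.
Qed.

Lemma clique_number_leq K S : s_partition K S -> clique_number G <= #|K|.+1.
Proof. by move=> pKS; apply/bigmax_leqP => C; apply: clique_leq pKS. Qed.

Lemma leq_clique_number C : clique C -> #|C| <= clique_number G.
Proof. by move=> cC; apply: leq_bigmax_cond. Qed.

Lemma clique0 : clique (set0 : {set G}).
Proof. by apply/cliqueP => u v; rewrite inE. Qed.

Lemma independent0 : independent (set0 : {set G}).
Proof. by apply/independentP => u v; rewrite inE. Qed.

(** * Pivots: vertices that fit on both sides of an s-partition *)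

Definition pivot K S w := s_partition (w |: K) S && s_partition K (w |: S).

Lemma pivot_of_indep K S w :
  s_partition K S -> w \in S -> K \subset nbhd w -> pivot K (S :\ w) w.
Proof.
move=> pKS wS /subsetP Kw; rewrite /pivot setD1K // pKS andbT.
have /s_partitionP[SK /cliqueP cK /independentP iS] := pKS.
apply/s_partitionP; split=> [v||]; first by rewrite !inE negb_or SK.
- apply/cliqueP => u v; rewrite !inE.
  case/predU1P=> [->|uK] /predU1P[->|vK]; rewrite ?eqxx // => uv.
  + by have := Kw v vK; rewrite in_nbhd.
  + by have := Kw u uK; rewrite in_nbhd adj_sym.
  + exact: cK.
- by apply/independentP => u v; rewrite !inE => /andP[_ uS] /andP[_]; apply: iS.
Qed.

Lemma pivot_of_clique K S w :
  s_partition K S -> w \in K -> [disjoint nbhd w & S] -> pivot (K :\ w) S w.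
Proof.
move=> pKS wK dw; rewrite /pivot setD1K // pKS /=.
have /s_partitionP[SK /cliqueP cK /independentP iS] := pKS.
have wS v : v \in S -> ~~ adj w v.
  by move=> vS; rewrite -in_nbhd (disjointFl dw vS).
apply/s_partitionP; split=> [v||].
- by rewrite !inE negb_and negbK SK.
- by apply/cliqueP => u v; rewrite !inE => /andP[_ uK] /andP[_]; apply: cK.
- apply/independentP => u v; rewrite !inE.
  case/predU1P=> [->|uS] /predU1P[->|vS]; rewrite ?adj_irrefl //.
  + exact: wS.
  + by rewrite adj_sym wS.
  + exact: iS.
Qed.

(** Each of the two s-partitions places [w] in one part, hence outside the other. *)
Lemma pivot_notin K S w : pivot K S w -> (w \notin K) * (w \notin S).
Proof.
case/andP=> /s_partitionP[SK _ _] /s_partitionP[KS _ _].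
by rewrite -KS setU11 SK setU11.
Qed.

Lemma nbhd_sub_clique K S v : s_partition K S -> v \in S -> nbhd v \subset K.
Proof.
case/s_partitionP=> SK _ /independentP iS vS; apply/subsetP => u.
by rewrite in_nbhd => vu; apply: contraLR vu; rewrite -SK; apply: iS.
Qed.

Lemma clique_sub_nbhd K v : clique K -> v \in K -> K :\ v \subset nbhd v.
Proof.
move=> /cliqueP cK vK; apply/subsetP => u; rewrite in_setD1 in_nbhd.
by case/andP=> uv uK; apply: cK; rewrite // eq_sym.
Qed.

Lemma pivot_nbhd K S w : pivot K S w -> nbhd w = K.
Proof.
move=> pw; have [wK _] := pivot_notin pw; case/andP: pw => pKS pKS'.
apply/eqP; rewrite eqEsubset (nbhd_sub_clique pKS') ?setU11 //=.
have /s_partitionP[_ cK _] := pKS.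
by rewrite -{1}(setU1K wK) clique_sub_nbhd ?setU11.
Qed.

Lemma pivot_clique_number K S w : pivot K S w -> clique_number G = #|K|.+1.
Proof.
move=> pw; have [wK _] := pivot_notin pw; case/andP: pw => pKS pKS'.
apply/eqP; rewrite eqn_leq (clique_number_leq pKS').
have /s_partitionP[_ cK _] := pKS.
by have := leq_clique_number cK; rewrite cardsU1 wK.
Qed.

Lemma pivot_deg K S w : pivot K S w -> deg w = clique_number G - 1.
Proof.
by move=> pw; rewrite /deg (pivot_nbhd pw) (pivot_clique_number pw) subn1.
Qed.

Lemma pivot_swing K S w : pivot K S w -> swing w.
Proof.
case/andP=> pKS pKS'; apply/existsP; exists (w |: K); apply/existsP; exists S.
apply/existsP; exists K; apply/existsP; exists (w |: S).
by rewrite pKS pKS' !setU11.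
Qed.

(** If [K] is not a maximum clique, a maximum clique [C] beats it although it has at most one vertex
    in [S]; so [C] is [K] plus a vertex [w] of [S], adjacent to all of [K]. The argument for [S] is
    dual. *)
Lemma unbalanced_pivot : unbalanced G -> exists K S w, pivot K S w.
Proof.
case/andP=> /andP[G0 /existsP[K /existsP[S pKS]]].
rewrite (balancedE G0 pKS) negb_and => /orP[neqK|neqS];
  have /s_partitionP[SK cK iS] := pKS.
- have [C cC eC] : exists2 C : {set G}, clique C & clique_number G = #|C|.
    have [|C ? ?] := @eq_bigmax_cond _ (@clique G) (fun C => #|C|);
      last by exists C.
    by apply/card_gt0P; exists set0; apply: clique0.
  have {neqK} ltKC : #|K| < #|C|.
    by rewrite -eC ltn_neqAle neqK leq_clique_number.
  have le1 := clique_independent_meet cC iS.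
  rewrite -(cardsID K C) (s_partition_setD _ pKS) in ltKC.
  (* [#|K| < #|C :&: K| + #|C :&: S|] with last term at most 1 leaves no room for a vertex of [K]
     outside [C]. *)
  have /eqP KC : C :&: K == K by rewrite eqEcard subsetIr; lia.
  have /card_gt0P[w] : 0 < #|C :&: S| by rewrite KC in ltKC; lia.
  rewrite inE => /andP[wC wS]; exists K, (S :\ w), w.
  apply: pivot_of_indep => //; apply/subsetP => v vK.
  rewrite in_nbhd; apply: (cliqueP _ cC) => //.
    by move: vK; rewrite -KC inE => /andP[].
  by apply: contraTneq vK => <-; rewrite -SK.
- have [I iI eI] :
      exists2 I : {set G}, independent I & independence_number G = #|I|.
    have [|I ? ?] := @eq_bigmax_cond _ (@independent G) (fun I => #|I|);
      last by exists I.
    by apply/card_gt0P; exists set0; apply: independent0.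
  have {neqS} ltSI : #|S| < #|I|.
    by rewrite -eI ltn_neqAle neqS; apply: leq_bigmax_cond.
  have le1 := clique_independent_meet cK iI.
  rewrite -(cardsID K I) (s_partition_setD _ pKS) setIC in ltSI.
  have /eqP SI : I :&: S == S by rewrite eqEcard subsetIr; lia.
  have /card_gt0P[w] : 0 < #|K :&: I| by rewrite SI in ltSI; lia.
  rewrite inE => /andP[wK wI]; exists (K :\ w), S, w.
  apply: pivot_of_clique => //; rewrite disjoint_sym disjoint_subset.
  apply/subsetP => v; rewrite -SI inE => /andP[vI _].
  by rewrite inE in_nbhd; apply: (independentP _ iI).
Qed.

(** * Degrees of swing vertices *)

Lemma deg_indep_lt K S v :
  s_partition K S -> v \in S -> deg v < clique_number G.
Proof.
move=> pKS vS; have sK := nbhd_sub_clique pKS vS.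
have /s_partitionP[_ cK _] := pKS.
have leK := leq_clique_number cK.
(* Otherwise [nbhd v] fills [K], so [v] is a pivot and the clique number is [#|K|.+1], which exceeds
   [deg v]. *)
rewrite ltnNge; apply/negP => le.
have /eqP NK : nbhd v == K by rewrite eqEcard sK (leq_trans leK).
have pv : pivot K (S :\ v) v by apply: pivot_of_indep; rewrite ?NK.
by rewrite (pivot_clique_number pv) in leK le; rewrite /deg NK ltnn in le.
Qed.

(** Without neighbours in [S], [v] is a pivot and its degree is known; with one, [v] has at least
    [#|K|] neighbours. *)
Lemma deg_clique_ge K S v :
  s_partition K S -> v \in K -> clique_number G - 1 <= deg v.
Proof.
move=> pKS vK; have /s_partitionP[SK cK _] := pKS.
have sN := clique_sub_nbhd cK vK.
case: (boolP [disjoint nbhd v & S]) => [dv|].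
  by rewrite (pivot_deg (pivot_of_clique pKS vK dv)).
rewrite -setI_eq0 => /set0Pn[u]; rewrite inE SK => /andP[uv uK].
have : #|u |: (K :\ v)| <= deg v.
  by apply: subset_leq_card; rewrite subUset sub1set uv.
rewrite cardsU1 in_setD1 (negbTE uK) andbF => le.
have := clique_number_leq pKS; rewrite (cardsD1 v K) vK; move: le => /=; lia.
Qed.

Lemma swing_deg v : swing v -> deg v = clique_number G - 1.
Proof.
case/existsP=> K /existsP[S /existsP[K' /existsP[S']]].
case/and4P=> pKS pKS' vK vS'.
(* The strict upper bound makes the clique number positive, so the truncated subtraction is
   exact. *)
have := deg_indep_lt pKS' vS'; have := deg_clique_ge pKS vK; lia.
Qed.

(** For a fixed pivot [w], the neighbourhood of [v] is contained in [K] or contains [(w |: K) :\ v].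
    Both sets have [#|K|] elements, as does [nbhd v], so equality holds and [v] is a pivot too. *)
Lemma deg_pivot v :
  unbalanced G -> deg v = clique_number G - 1 -> exists K S, pivot K S v.
Proof.
case/unbalanced_pivot=> K [S [w pw]]; rewrite (pivot_clique_number pw) subn1 /=.
have [wK _] := pivot_notin pw; case/andP: pw => pKS pKS' dv.
have /s_partitionP[SK cK _] := pKS.
case: (boolP (v \in w |: K)) => [vK|]; last first.
  rewrite -SK => vS; exists K, ((w |: S) :\ v).
  have vS' : v \in w |: S by rewrite inE vS orbT.
  apply: pivot_of_indep => //.
  have /eqP -> // : nbhd v == K.
  by rewrite eqEcard (nbhd_sub_clique pKS') // -dv /=.
exists ((w |: K) :\ v), S; apply: pivot_of_clique => //.
have /eqP <- : (w |: K) :\ v == nbhd v.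
  rewrite eqEcard clique_sub_nbhd // -/(deg v) dv.
  by have := cardsU1 w K; rewrite (cardsD1 v) vK wK; lia.
rewrite disjoint_subset; apply/subsetP => u; rewrite in_setD1 => /andP[_ uK].
by rewrite inE SK uK.
Qed.

Lemma swing_pivot v : unbalanced G -> swing v -> exists K S, pivot K S v.
Proof. by move=> uG /swing_deg; apply: deg_pivot. Qed.

(** * Twins among the swing vertices *)

Lemma swing_twins u v : unbalanced G -> swing u -> swing v -> twins u v.
Proof.
move=> uG /(swing_pivot uG)[K [S pu]] /swing_deg.
rewrite (pivot_clique_number pu) subn1 /= => dv.
rewrite /twins (pivot_nbhd pu).
have [uK _] := pivot_notin pu; case/andP: pu => pKS pKS'.
have /s_partitionP[SK cK _] := pKS.
(* Counting determines [nbhd v]: it is [K] if [v] lies in [S], and [(u |: K) :\ v] otherwise. *)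
case: (boolP (v \in u |: K)) => [vK|]; last first.
  rewrite -SK => vS; have vS' : v \in u |: S by rewrite inE vS orbT.
  have sN := nbhd_sub_clique pKS' vS'.
  have /eqP -> : nbhd v == K by rewrite eqEcard sN -dv /=.
  have /s_partitionP[SK' _ _] := pKS'.
  by apply/eqP/setP => x; rewrite !in_setD1; do 2?case: eqP => [->|_] //;
     rewrite ?(negbTE uK) //; move: vS'; rewrite SK' => /negbTE->.
have /eqP <- : (u |: K) :\ v == nbhd v.
  rewrite eqEcard clique_sub_nbhd // -/(deg v) dv.
  by have := cardsU1 u K; rewrite (cardsD1 v) vK uK; lia.
apply/eqP/setP => x; rewrite !inE; case: (x =P u) => [->|_] //=.
by rewrite (negbTE uK) andbF.
Qed.

Lemma twins_adj u v w : twins u v -> w != u -> w != v -> adj u w = adj v w.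
Proof.
by move=> /eqP/setP/(_ w) + wu wv; rewrite !inE wu wv.
Qed.

(** A single edge [a b] inside [A] spreads to all pairs, by exchanging one endpoint at a time for a
    twin. *)
Lemma twins_clique_or_independent A :
  {in A &, forall u v, twins u v} -> clique A \/ independent A.
Proof.
move=> tA; case: (boolP (independent A)) => [|nA]; [by right | left].
move: nA; rewrite negb_forall_in => /exists_inP[a aA].
rewrite negb_forall_in => /exists_inP[b bA]; rewrite negbK => ab.
have adja v : v \in A -> v != a -> adj a v.
  move=> vA va; have [-> //|vb] := eqVneq v b.
  rewrite (twins_adj (tA _ _ aA bA)) // adj_sym.
  rewrite (twins_adj (tA _ _ vA aA)) // 1?eq_sym //.
  by apply: contraTneq ab => ->; rewrite adj_irrefl.
apply/cliqueP => u v uA vA uv; have [va|va] := eqVneq v a.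
  by rewrite va adj_sym adja // -va.
by rewrite (twins_adj (tA _ _ uA aA)) ?adja // eq_sym.
Qed.

Lemma notin_Sstar v :
  v \notin Sstar G -> exists K S, s_partition K S && (v \in K).
Proof.
move=> vS; have /exists_inP[[K S] /= pKS vK] :
    [exists P : {set G} * {set G} in [pred P | s_partition P.1 P.2],
       v \notin P.2].
  apply: contraR vS; rewrite negb_exists_in => /forall_inP sS.
  by apply/bigcapP => P pP; have := sS P pP; rewrite negbK.
exists K, S; move: vK; rewrite inE /= in pKS *.
by have /s_partitionP[-> _ _] := pKS; rewrite negbK pKS.
Qed.

End SplitGraphs.

(** * Null vectors and the support *)

Section Support.
Import Order.TTheory GRing.Theory Num.Theory.
Local Open Scope ring_scope.
Variables (R : realType) (G : sgraph).
Implicit Types (K S : {set G}) (u v w : G) (f : G -> R).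

(** Kernel vectors as functions on the vertices, so that sums can range over vertex sets; [SuppP]
    translates. *)
Definition null_vector f := forall v, \sum_u (adj v u)%:R * f u = 0.

Lemma sum_enum_val (F : G -> R) :
  \sum_u F u = \sum_(i < #|G|) F (enum_val i).
Proof.
by rewrite (reindex (@enum_val G xpredT)) //; apply/onW_bij/enum_val_bij.
Qed.

Lemma SuppP v :
  reflect (exists2 f, null_vector f & f v != 0) (v \in Supp R G).
Proof.
rewrite inE; apply: (iffP (asboolP _)) => [[x [Ax xv]]|[f nf fv]].
  exists (fun u => x (enum_rank u) 0) => // w.
  have /matrixP/(_ (enum_rank w) 0) := Ax; rewrite !mxE; apply: etrans.
  rewrite sum_enum_val.
  by apply: eq_bigr => i _; rewrite mxE enum_rankK enum_valK.
exists (\col_i f (enum_val i)); split; last by rewrite mxE enum_rankK.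
apply/matrixP => i j; rewrite !mxE -[RHS](nf (enum_val i)) sum_enum_val.
by apply: eq_bigr => k _; rewrite !mxE.
Qed.

Lemma null_vector_pivot f K S w v :
  null_vector f -> pivot K S w -> v \in K -> f v = 0.
Proof.
move=> nf pw; have NK := pivot_nbhd pw; case/andP: pw => _.
(* From here on [S] stands for the former [w |: S], the independent part opposite [K]. *)
set S' := w |: S; move: S' => {}S pKS.
have /s_partitionP[SK /cliqueP cK iS] := pKS.
have sumK0 : \sum_(u in K) f u = 0.
  rewrite -[RHS](nf w) -NK big_mkcond; apply: eq_bigr => u _.
  by rewrite in_nbhd; case: adj; rewrite (mul1r, mul0r).
have split_sum (F : G -> R) : \sum_u F u = \sum_(u in K) F u + \sum_(u in S) F u.
  rewrite (bigID (mem K)) /=; congr (_ + _).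
  by apply: eq_bigl => u; rewrite SK.
(* By [sumK0] the values on [K] other than [f k] sum to [- f k]. *)
have fK k : k \in K -> f k = \sum_(s in S) (adj k s)%:R * f s.
  move=> kK; have := nf k; rewrite split_sum (bigD1 k) //= adj_irrefl mul0r add0r.
  rewrite (eq_bigr f) => [|u /andP[uK uk]]; last first.
    by rewrite cK ?mul1r // eq_sym.
  move: sumK0; rewrite (bigD1 k) //= => /eqP.
  by rewrite addr_eq0 => /eqP-> /eqP; rewrite addrC addr_eq0 => /eqP->.
have sum_sq0 : \sum_(k in K) f k ^+ 2 = 0.
  have -> : \sum_(k in K) f k ^+ 2 =
            \sum_(k in K) \sum_(s in S) f s * ((adj s k)%:R * f k).
    apply: eq_bigr => k kK; rewrite expr2 {2}(fK k kK) mulr_sumr.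
    by apply: eq_bigr => s _; rewrite adj_sym mulrA mulrC [f k * _]mulrC.
  (* After the exchange the inner sum over [K] is the whole equation at [s], since [s] has no
     neighbour in [S]. *)
  rewrite exchange_big big1 // => s sS /=; rewrite -mulr_sumr.
  have := nf s; rewrite split_sum [X in _ + X]big1 ?addr0 => [->|u uS].
    by rewrite mulr0.
  by move/independentP: iS => /(_ s u sS uS)/negbTE->; rewrite mul0r.
move=> vK; apply/eqP; rewrite -sqrf_eq0.
by rewrite (psumr_eq0P _ sum_sq0) // => u _; apply: sqr_ge0.
Qed.

Lemma pivot_Supp K S w v : pivot K S w -> v \in K -> v \notin Supp R G.
Proof.
move=> pw vK; apply/SuppP => -[f nf].
by rewrite (null_vector_pivot nf pw vK) eqxx.
Qed.

(** A support vertex avoids the [K] of a pivot, so it lies in the independent part [w |: S]. If it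
    is not in [Sstar G], some other s-partition has it in the clique, and the two partitions make it
    swing. *)
Lemma Supp_sub_Sstar_swing :
  unbalanced G -> Supp R G \subset Sstar G :|: swing_set G.
Proof.
move=> /unbalanced_pivot[K [S [w pw]]]; apply/subsetP => v vsupp.
rewrite inE; case: (boolP (v \in Sstar G)) => //= /notin_Sstar[K' [S']].
case/andP=> pKS' vK'; rewrite inE.
have vK : v \notin K by apply: contraTN vsupp; apply: pivot_Supp pw.
have /andP[_ pKS] := pw; have /s_partitionP[SK _ _] := pKS.
rewrite -SK in vK.
apply/existsP; exists K'; apply/existsP; exists S'.
apply/existsP; exists K; apply/existsP; exists (w |: S).
by rewrite pKS' pKS vK'.
Qed.

(** The difference of the indicators of [u] and [v] is a null vector: non-adjacent twins have equal
    neighbourhoods. *)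
Lemma twins_Supp u v :
  u != v -> ~~ adj u v -> twins u v -> u \in Supp R G.
Proof.
move=> uv auv tuv; apply/SuppP.
exists (fun x => (x == u)%:R - (x == v)%:R); last first.
  by rewrite eqxx (negbTE uv) subr0 oner_neq0.
move=> w; rewrite (eq_bigr (fun x => (adj w x)%:R * (x == u)%:R -
                                     (adj w x)%:R * (x == v)%:R)); last first.
  by move=> x _; rewrite mulrBr.
have pick z : \sum_x (adj w x)%:R * (x == z)%:R = (adj w z)%:R :> R.
  rewrite (bigD1 z) //= eqxx mulr1 big1 ?addr0 // => x /negbTE->.
  by rewrite mulr0.
rewrite sumrB !pick; suff -> : adj w u = adj w v by rewrite subrr.
have [->|wu] := eqVneq w u; first by rewrite adj_irrefl (negbTE auv).
have [->|wv] := eqVneq w v; first by rewrite adj_irrefl adj_sym (negbTE auv).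
by rewrite ![adj w _]adj_sym; apply: twins_adj.
Qed.

End Support.

Theorem theorem4p12 (R : realType) (Sp : sgraph) (hSp : unbalanced Sp) :
  [/\ swing_set Sp = [set v : Sp | deg v == clique_number Sp - 1],
      (clique (swing_set Sp) \/ independent (swing_set Sp)) /\
        {in swing_set Sp &, forall u v : Sp, twins u v},
      forall w : Sp, swing_set Sp = [set w] ->
        Supp R Sp \subset Sstar Sp :|: [set w],
      clique (swing_set Sp) -> 2 <= #|swing_set Sp| ->
        Supp R Sp \subset Sstar Sp /\ swing_set Sp :&: Supp R Sp = set0
    & independent (swing_set Sp) -> 2 <= #|swing_set Sp| ->
        swing_set Sp \subset Supp R Sp /\
        Supp R Sp \subset Sstar Sp :|: swing_set Sp].
Proof.
have twW : {in swing_set Sp &, forall u v : Sp, twins u v}.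
  by move=> u v; rewrite !inE; apply: swing_twins.
have suppW := Supp_sub_Sstar_swing R hSp.
have other v : 2 <= #|swing_set Sp| -> exists2 u, u \in swing_set Sp & u != v.
  move=> W2; have /card_gt0P[u] : 0 < #|swing_set Sp :\ v|.
    by move: W2; rewrite (cardsD1 v); case: (v \in _); lia.
  by rewrite in_setD1 => /andP[uv uW]; exists u.
split.
- apply/setP => v; rewrite !inE; apply/idP/eqP; first exact: swing_deg.
  by case/(deg_pivot hSp)=> K [S]; apply: pivot_swing.
- by split=> //; apply: twins_clique_or_independent.
- by move=> w <-.
- move=> /cliqueP cW W2.
  (* Another swing vertex [u] is adjacent to [v], so [v] lies in the clique [K] of the pivot [u],
     where null vectors vanish. *)
  have WS0 : swing_set Sp :&: Supp R Sp = set0.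
    apply/setP => v; rewrite in_setI in_set0; apply/negbTE/negP => /andP[vW vs].
    have [u uW uv] := other v W2.
    have [K [S pu]] : exists K S, pivot K S u.
      by apply: swing_pivot => //; rewrite inE in uW.
    move: vs; apply/negP; apply: (pivot_Supp R pu).
    by rewrite -(pivot_nbhd pu) in_nbhd cW.
  split=> //; apply/subsetP => v vs.
  move/subsetP: suppW => /(_ v vs); rewrite in_setU => /orP[//|vW].
  by have := in_set0 v; rewrite -WS0 in_setI vW vs.
- move=> /independentP iW W2; split=> //; apply/subsetP => v vW.
  have [u uW uv] := other v W2.
  by apply: (@twins_Supp _ _ v u); rewrite 1?eq_sym ?iW ?twW.
Qed.
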